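(* Let $G\subseteq R_k$, let $\rho$ be an essential predicate of arity $n$ with $n>2^{2k^{2}}+2$, and let $\rho_1,\dots,\rho_n\in[G]$ be such that $$\rho(x_1,\dots,x_n)=\exists y_1\dots\exists y_{n-1}\;\rho_1(x_1,y_1)\wedge\rho_2(y_1,x_2,y_2)\wedge\rho_3(y_2,x_3,y_3)\wedge\dots\wedge\rho_{n-1}(y_{n-2},x_{n-1},y_{n-1})\wedge\rho_n(y_{n-1},x_n).$$ Then $[G]$ contains infinitely many essential predicates.
   Context: $E_k=\{0,\dots,k-1\}$; $R_k$ is the set of all predicates $E_k^n\to\{0,1\}$, $n\ge0$. For $S\subseteq R_k$, $[S]$ is the set of all predicates expressible by a formula $\exists y_1\dots\exists y_l$ (conjunction of atoms $\rho_i(z_{i,1},\dots,z_{i,n_i})$) with $\rho_i\in S\cup\{=,\mathrm{false}\}$ ($=$ binary equality, $\mathrm{false}$ the $0$-ary predicate with value $0$). A predicate of arity $n$ is essential if it cannot be written as a conjunction of predicates of arity $<n$ each applied to pairwise distinct variables among its $n$ variables. *)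

(* Defs.v *)
From mathcomp Require Import all_boot.
From mathcomp Require Import boolp classical_sets cardinality.

Set Implicit Arguments.
Unset Strict Implicit.
Unset Printing Implicit Defensive.

Definition predicate (k n : nat) := {ffun n.-tuple 'I_k -> bool}.

(* Predicates of different arities are different elements of [R_ k]. *)
Definition R_ (k : nat) := {n : nat & predicate k n}.

Definition eq_pred (k : nat) : predicate k 2 :=
  [ffun t => tnth t ord0 == tnth t ord_max].

Definition false_pred (k : nat) : predicate k 0 := [ffun => false].

(* The atom [rho(z_1, ..., z_m)] with variables [z_i] taken from [V]; the z_i
   need not be distinct. *)
Definition atom (k : nat) (V : finType) := {p : R_ k & (tag p).-tuple V}.

Definition atom_holds (k : nat) (V : finType) (v : V -> 'I_k) (a : atom k V) :
    bool :=
  tagged (tag a) (map_tuple v (tagged a)).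

(* Free variables x_1, ..., x_n are tagged [inl], bound ones [inr]. *)
Definition valuation (k n l : nat) (x : n.-tuple 'I_k) (y : l.-tuple 'I_k)
    (z : 'I_n + 'I_l) : 'I_k :=
  match z with inl i => tnth x i | inr j => tnth y j end.

(* The predicate of x defined by
   [exists y_1 ... y_l, conjunction of the atoms in c]. *)
Definition pp_pred (k n l : nat) (c : seq (atom k ('I_n + 'I_l)%type)) :
    predicate k n :=
  [ffun x => [exists y : l.-tuple 'I_k, all (atom_holds (valuation x y)) c]].

Definition pp_closure (k : nat) (S : set (R_ k)) : set (R_ k) :=
  [set p | exists (l : nat) (c : seq (atom k ('I_(tag p) + 'I_l)%type)),
     (forall a, a \in c ->
        [\/ S (tag a), tag a = Tagged (predicate k) (eq_pred k)
          | tag a = Tagged (predicate k) (false_pred k)])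
     /\ tagged p = pp_pred c]%classic.

Definition essential (k n : nat) (rho : predicate k n) : Prop :=
  ~ exists c : seq (atom k 'I_n),
      (forall a, a \in c -> tag (tag a) < n /\ uniq (tagged a))
      /\ (forall x : n.-tuple 'I_k, rho x = all (atom_holds (tnth x)) c).

(* Main.v *)
Require Import Defs.
From mathcomp Require Import all_boot.
From mathcomp Require Import boolp classical_sets cardinality.
From mathcomp Require Import zify.

(** A predicate is essential iff some [a] falsifies it although each single
    coordinate of [a] can be changed so as to satisfy it. Read the chain as an
    automaton with states [y_i] reading [x_i]; along such an [a], record at each
    [i] the set of states reachable at [i] and the set of states at [i] from
    which the rest of [a] can be read. There are at most [2 ^ (2 * k)] such pairs,
    so two positions share the same pair, and repeating the factor of the chain
    between them gives a longer chain with the same property. *)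

Set Implicit Arguments.
Unset Strict Implicit.
Unset Printing Implicit Defensive.

(** * Essential predicates and critical tuples *)

Section Essential.
Variables k n : nat.
Implicit Types (rho : predicate k n) (a b : n.-tuple 'I_k).

Definition change a b (i : 'I_n) : n.-tuple 'I_k :=
  [tuple if j == i then tnth b j else tnth a j | j < n].

(** An atom of arity below [n] misses some variable [i], so it cannot tell [a] from [change a b i].
    Hence every atom of a decomposition would hold at [a]. *)
Lemma essential_of_critical rho a b :
  ~~ rho a -> (forall i, rho (change a b i)) -> essential rho.
Proof.
move=> rhoa rhob [c [c_small rhoE]].
move: rhoa; rewrite rhoE => /allPn[e ec /negP]; apply.
have [lt_n _] := c_small e ec.
have [i iNe] : exists i, i \notin tagged e.
  apply/existsP; rewrite -negb_forall; apply/negP => /forallP all_e.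
  have: n <= size (tagged e).
    apply: leq_trans (card_size (tagged e)); rewrite -[leqLHS]card_ord.
    by apply: subset_leq_card; apply/fintype.subsetP => j _; exact: all_e.
  by rewrite size_tuple leqNgt lt_n.
have := rhob i; rewrite rhoE => /allP/(_ e ec); rewrite /atom_holds.
congr (is_true (tagged (tag e) _)); apply: val_inj; apply/eq_in_map => j je /=.
by rewrite tnth_mktuple; case: eqVneq => // ji; rewrite -ji je in iNe.
Qed.

(** The natural candidate for a decomposition is the conjunction of the [n] projections of [rho],
    each forgetting one coordinate. It follows from [rho], and a tuple that separates the two is the
    required [a]. *)
Lemma critical_of_essential rho :
  essential rho ->
  exists a b, ~~ rho a /\ forall i, rho (change a b i).
Proof.
move=> ess; apply: contrapT => ncrit; apply: ess.
pose proj (i : 'I_n) : predicate k n.-1 := [ffun t =>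
  [exists x : n.-tuple 'I_k, rho x && [forall j, tnth x (lift i j) == tnth t j]]].
pose at_ (i : 'I_n) : atom k 'I_n :=
  @existT (R_ k) (fun p => (tag p).-tuple 'I_n) (Tagged (predicate k) (proj i))
    [tuple lift i j | j < n.-1].
exists [seq at_ i | i <- enum 'I_n]; split.
  move=> e /mapP[i _ ->] /=; split; first by have := ltn_ord i; lia.
  by rewrite map_inj_uniq ?enum_uniq //; exact: lift_inj.
move=> x; apply/idP/idP => [rhox|/allP holds].
  apply/allP => _ /mapP[i _ ->]; rewrite /atom_holds /= ffunE.
  apply/existsP; exists x; rewrite rhox; apply/forallP => j.
  by rewrite tnth_map tnth_mktuple.
apply: contraPT isT => nrhox _; apply: ncrit.
(* The value forgotten by the projection along [i] repairs [x] at [i]; these values together form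
   the second tuple. *)
have /fin_all_exists[b bP] : forall i, exists v,
    rho [tuple if j == i then v else tnth x j | j < n].
  move=> i; have /holds : at_ i \in [seq at_ i | i <- enum 'I_n].
    by rewrite map_f ?mem_enum.
  rewrite /atom_holds /= ffunE => /existsP[z /andP[rhoz /forallP zE]].
  exists (tnth z i); congr (is_true (rho _)): rhoz.
  apply: eq_from_tnth => j; rewrite tnth_mktuple.
  case: (unliftP i j) => [j'|] ->; last by rewrite eqxx.
  rewrite eq_sym (negbTE (neq_lift _ _)) (eqP (zE j')).
  by rewrite tnth_map tnth_mktuple.
exists x, [tuple b i | i < n]; split=> // i.
congr (is_true (rho _)): (bP i); apply: eq_from_tnth => j.
by rewrite !tnth_mktuple; case: eqP => // ->.
Qed.

End Essential.

(** * Closure properties of primitive positive definability *)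

Section Definable.
Variables (k : nat) (G : set (R_ k)).

Definition sum_val (V W : Type) (v : V -> 'I_k) (w : W -> 'I_k) (z : V + W) :=
  match z with inl i => v i | inr j => w j end.

Definition pp_base (p : R_ k) : Prop :=
  [\/ G p, p = Tagged (predicate k) (eq_pred k)
    | p = Tagged (predicate k) (false_pred k)].

(** Free and bound variables range over arbitrary finite types and assignments are plain functions,
    so formulas can be combined without index arithmetic. *)
Definition pp_definable (V : finType) (f : (V -> 'I_k) -> Prop) : Prop :=
  exists (W : finType) (c : seq (atom k (V + W)%type)),
    (forall a, a \in c -> pp_base (tag a)) /\
    forall v, f v <-> exists w, all (atom_holds (sum_val v w)) c.

Definition atom_map (V W : finType) (h : V -> W) (a : atom k V) : atom k W :=
  @existT (R_ k) (fun p => (tag p).-tuple W) (tag a) (map_tuple h (tagged a)).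

Lemma atom_holds_map (V W : finType) (h : V -> W) v a :
  atom_holds v (atom_map h a) = atom_holds (v \o h) a.
Proof.
rewrite /atom_holds /=; congr (tagged (tag a) _).
by apply: val_inj; rewrite /= -map_comp.
Qed.

Lemma eq_atom_holds (V : finType) (v w : V -> 'I_k) :
  v =1 w -> atom_holds v =1 atom_holds w.
Proof. by move=> /funext ->. Qed.

Lemma all_atom_map (V W : finType) (h : V -> W) v w c : v \o h =1 w ->
  all (atom_holds v) (map (atom_map h) c) = all (atom_holds w) c.
Proof.
move=> vh; rewrite all_map; apply: eq_all => a /=.
by rewrite atom_holds_map; exact: eq_atom_holds.
Qed.

Lemma pp_base_map (V W : finType) (h : V -> W) (c : seq (atom k V)) :
  (forall a, a \in c -> pp_base (tag a)) ->
  forall a, a \in map (atom_map h) c -> pp_base (tag a).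
Proof. by move=> cG _ /mapP[a ac ->]; exact: cG. Qed.

Lemma pp_definable_ext (V : finType) (f g : (V -> 'I_k) -> Prop) :
  (forall v, f v <-> g v) -> pp_definable f -> pp_definable g.
Proof.
move=> fg [W [c [cG fE]]]; exists W, c; split=> // v.
by rewrite -fE; split=> /fg.
Qed.

Lemma pp_definable_true (V : finType) : pp_definable (fun _ : V -> 'I_k => True).
Proof.
exists void, [::]; split=> // v; split=> // _.
by exists (fun x : void => match x with end).
Qed.

Lemma pp_definable_and (V : finType) (f g : (V -> 'I_k) -> Prop) :
  pp_definable f -> pp_definable g -> pp_definable (fun v => f v /\ g v).
Proof.
move=> [W1 [c1 [c1G fE]]] [W2 [c2 [c2G gE]]].
pose h1 (z : V + W1) : V + (W1 + W2) :=
  match z with inl i => inl i | inr j => inr (inl j) end.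
pose h2 (z : V + W2) : V + (W1 + W2) :=
  match z with inl i => inl i | inr j => inr (inr j) end.
exists (W1 + W2)%type, (map (atom_map h1) c1 ++ map (atom_map h2) c2); split.
  by move=> a; rewrite mem_cat => /orP[]; exact: pp_base_map.
move=> v; rewrite fE gE; split=> [[[w1 w1P] [w2 w2P]]|[w]].
  exists (sum_val w1 w2); rewrite all_cat.
  rewrite (@all_atom_map _ _ _ _ (sum_val v w1)) ?w1P; last by case.
  by rewrite (@all_atom_map _ _ _ _ (sum_val v w2)) ?w2P //; case.
rewrite all_cat => /andP[].
rewrite (@all_atom_map _ _ _ _ (sum_val v (w \o inl))); last by case.
rewrite (@all_atom_map _ _ _ _ (sum_val v (w \o inr))); last by case.
by split; [exists (w \o inl) | exists (w \o inr)].
Qed.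

Lemma pp_definable_rename (V V' : finType) (h : V -> V')
    (f : (V -> 'I_k) -> Prop) :
  pp_definable f -> pp_definable (fun v => f (v \o h)).
Proof.
move=> [W [c [cG fE]]].
pose h' (z : V + W) : V' + W :=
  match z with inl i => inl (h i) | inr j => inr j end.
exists W, (map (atom_map h') c); split; first exact: pp_base_map.
move=> v; rewrite fE.
by split=> -[w wP]; exists w; move: wP;
  rewrite (@all_atom_map _ _ _ _ (sum_val (v \o h) w)) //; case.
Qed.

Lemma pp_definable_ex (V U : finType) (f : (V + U -> 'I_k) -> Prop) :
  pp_definable f -> pp_definable (fun v => exists u, f (sum_val v u)).
Proof.
move=> [W [c [cG fE]]].
pose h (z : V + U + W) : V + (U + W) :=
  match z with
  | inl (inl i) => inl i | inl (inr j) => inr (inl j) | inr l => inr (inr l)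
  end.
exists (U + W)%type, (map (atom_map h) c); split; first exact: pp_base_map.
move=> v; split=> [[u /fE[w wP]]|[w wP]].
  exists (sum_val u w).
  by rewrite (@all_atom_map _ _ _ _ (sum_val (sum_val v u) w)) // => -[[]|].
exists (w \o inl); apply/fE; exists (w \o inr); move: wP.
by rewrite (@all_atom_map _ _ _ _ (sum_val (sum_val v (w \o inl)) (w \o inr)))
  // => -[[]|].
Qed.

Lemma pp_definable_all (V I : finType) (f : I -> (V -> 'I_k) -> Prop) :
  (forall i, pp_definable (f i)) -> pp_definable (fun v => forall i, f i v).
Proof.
move=> fD; apply: (@pp_definable_ext _ (fun v => forall i, i \in enum I -> f i v)).
  move=> v; split=> fv i; last by move=> _; exact: fv.
  by apply: fv; rewrite mem_enum.
elim: (enum I) => [|i s IHs].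
  by apply: pp_definable_ext (pp_definable_true V).
apply: pp_definable_ext (pp_definable_and (fD i) IHs) => v; split.
  by move=> [fi fs] j; rewrite inE => /predU1P[->|/fs].
by move=> fs; split=> [|j js]; apply: fs; rewrite inE ?eqxx ?js ?orbT.
Qed.

(** Bridge to the closure with numbered variables: [enum_rank] numbers the bound variables of an
    arbitrary finite type. *)
Lemma pp_definableP n (p : predicate k n) :
  pp_closure G (Tagged (predicate k) p) <->
  pp_definable (fun v : 'I_n -> 'I_k => p [tuple v i | i < n]).
Proof.
split=> [[l [c [cG /= ->]]]|[W [c [cG pE]]]].
  exists 'I_l, c; split=> // v; rewrite ffunE.
  have vE (y : l.-tuple 'I_k) : valuation [tuple v i | i < n] y =1 sum_val v (tnth y).
    by case=> //= i; rewrite tnth_mktuple.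
  split=> [/existsP[y]|[w wP]].
    by rewrite (eq_all (eq_atom_holds (vE y))); exists (tnth y).
  apply/existsP; exists [tuple w i | i < l].
  rewrite (eq_all (eq_atom_holds (vE _))); congr (is_true (all (atom_holds _) c)): wP.
  by apply/funext => -[|j] //=; rewrite tnth_mktuple.
pose h (z : 'I_n + W) : 'I_n + 'I_#|W| :=
  match z with inl i => inl i | inr w => inr (enum_rank w) end.
exists #|W|, (map (atom_map h) c); split; first exact: pp_base_map.
apply/ffunP => x; rewrite ffunE /=.
have xE : [tuple tnth x i | i < n] = x.
  by apply: eq_from_tnth => i; rewrite tnth_mktuple.
rewrite -[in LHS]xE; apply/idP/existsP => [/pE[w wP]|[y yP]].
  exists [tuple w (enum_val j) | j < #|W|].
  rewrite (@all_atom_map _ _ _ _ (sum_val (tnth x) w)) // => -[|j] //=.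
  by rewrite tnth_mktuple enum_rankK.
apply/pE; exists (fun w => tnth y (enum_rank w)); move: yP.
by rewrite (@all_atom_map _ _ _ _ (sum_val (tnth x)
  (fun w => tnth y (enum_rank w)))) // => -[].
Qed.

Lemma pp_closure_rename m n (h : 'I_m -> 'I_n) (p : predicate k m)
    (q : predicate k n) :
  (forall x, q x = p [tuple tnth x (h i) | i < m]) ->
  pp_closure G (Tagged (predicate k) p) -> pp_closure G (Tagged (predicate k) q).
Proof.
move=> qE /pp_definableP/(pp_definable_rename h) pD; apply/pp_definableP.
apply: pp_definable_ext pD => v; rewrite qE.
suff -> : [tuple tnth [tuple v i | i < n] (h i) | i < m] =
          [tuple (v \o h) i | i < m] by [].
by apply: eq_from_tnth => i; rewrite !tnth_mktuple.
Qed.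

End Definable.

(** * Chains of ternary predicates as automata, and their pumping *)

Section Chain.
Variable k : nat.
Implicit Types (T : nat -> predicate k 3) (x y a b : nat -> 'I_k).

Definition step T x y i : bool := T i [tuple y i; x i; y i.+1].

Definition accepts T n x : Prop := exists y, forall i, i < n -> step T x y i.

Definition change_at a b t : nat -> 'I_k := fun s => if s == t then b s else a s.

(** The criterion for essential predicates, transferred from tuples to words on [nat]. *)
Definition critical T n a b : Prop :=
  ~ accepts T n a /\ forall t, t < n -> accepts T n (change_at a b t).

Definition reach T a i : {set 'I_k} :=
  [set q | `[< exists y, y i = q /\ forall s, s < i -> step T a y s >]].

Definition coreach T n a i : {set 'I_k} :=
  [set q | `[< exists y, y i = q /\ forall s, i <= s < n -> step T a y s >]].

Lemma repeated_state T n a : 2 ^ (2 * k) <= n ->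
  exists i j, [/\ i < j, j <= n, reach T a i = reach T a j
                & coreach T n a i = coreach T n a j].
Proof.
move=> le_n.
pose st (i : 'I_n.+1) := (reach T a i, coreach T n a i).
have /injectivePn[i [j neq_ij [eqr eqc]]] : ~~ injectiveb st.
  apply/negP => /injectiveP/leq_card.
  have card_states : #|{set 'I_k}| = 2 ^ k.
    by rewrite -cardsT -powersetT card_powerset cardsT card_ord.
  rewrite card_prod card_states card_ord -expnD addnn -mul2n.
  by rewrite leqNgt ltnS le_n.
move: neq_ij; rewrite neq_ltn => /orP[lt_ij|lt_ij].
  by exists i, j; split=> //; rewrite -ltnS.
by exists j, i; split=> //; rewrite -ltnS.
Qed.

(* The glued run follows [y1] up to position [m1], then [y2] from its position
   [m2] on; [N1] and [N] are the lengths of [x2] and [x]. *)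
Lemma glue T T1 T2 x x1 x2 y1 y2 m1 m2 N1 N :
  y1 m1 = y2 m2 -> N1 + m1 = N + m2 -> m2 <= N1 ->
  (forall s, s < m1 -> [/\ T s = T1 s, x s = x1 s & step T1 x1 y1 s]) ->
  (forall s, m2 <= s < N1 ->
     [/\ T (s - m2 + m1) = T2 s, x (s - m2 + m1) = x2 s & step T2 x2 y2 s]) ->
  accepts T N x.
Proof.
move=> eqy eqN le1 H1 H2.
exists (fun s => if s < m1 then y1 s else y2 (s - m1 + m2)) => s lt_s.
rewrite /step; case: (ltnP s m1) => [lt_sm|le_ms].
  have [-> -> st] := H1 s lt_sm; rewrite /step in st.
  (* The last step along [y1] already ends in a state taken from [y2]; the two agree by [eqy]. *)
  case: ltnP => // le_m; have eq_m : m1 = s.+1 by lia.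
  by rewrite -eq_m subnn add0n -eqy eq_m.
have [|] := H2 (s - m1 + m2); first by lia.
have -> : s - m1 + m2 - m2 + m1 = s by lia.
rewrite ltnNge (leqW le_ms) /= /step => -> ->.
by have -> : s.+1 - m1 + m2 = (s - m1 + m2).+1 by lia.
Qed.

(** [g] runs through the positions below [j] and then through those from [i] to [n - 1], so the
    links and letters between [i] and [j] occur twice. Equal [reach] sets give rejection and handle
    changes from [j] on; equal [coreach] sets handle changes before [j]. *)
Lemma pump T n a b : 2 ^ (2 * k) <= n -> critical T n a b ->
  exists d (g : nat -> nat), [/\ 0 < d, forall s, s < n + d -> g s < n
    & critical (T \o g) (n + d) (a \o g) (b \o g)].
Proof.
move=> le_n [rej acc].
have [i [j [lt_ij le_jn eqr eqc]]] := repeated_state T a le_n.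
pose d := j - i; pose g s := if s < j then s else s - d.
have gl s : s < j -> g s = s by rewrite /g => ->.
have gr s : i <= s -> g (s - i + j) = s.
  by rewrite /g /d => le_is; case: ltnP; lia.
exists d, g; split; first by rewrite /d; lia.
  by move=> s; rewrite /g /d; case: (ltnP s j); lia.
split.
  move=> [y yP].
  (* A run on the longer word enters the second copy in a state reachable at [i], so cutting out the
     first copy would yield a run on [a]. *)
  have : y j \in reach T a i.
    rewrite eqr inE; apply/asboolP; exists y; split=> // s lt_sj.
    have := yP s; rewrite /step /= gl //; apply; lia.
  rewrite inE => /asboolP[z [zi zP]]; apply: rej.
  apply: (@glue T T T a a a z (fun s => y (s - i + j)) i i n) => //.
  - by rewrite zi subnn.
  - by lia.
  - by move=> s lt_si; split=> //; exact: zP.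
  move=> s /andP[le_is lt_sn]; rewrite subnK //; split=> //.
  have := yP (s - i + j); rewrite /step /= gr // subSn // addSn.
  by apply; rewrite /d; lia.
move=> t lt_t; case: (ltnP t j) => [lt_tj|le_jt].
  (* The change lies before the second copy. The run on the changed original word is followed up to
     [j]; its state there can also read the unchanged word from [i] on. *)
  have [y yP] : accepts T n (change_at a b t) by apply: acc; lia.
  have : y j \in coreach T n a i.
    rewrite eqc inE; apply/asboolP; exists y; split=> // s /andP[le_js lt_sn].
    have := yP s lt_sn; rewrite /step /change_at.
    by case: eqP => // eq_st; lia.
  rewrite inE => /asboolP[z [zi zP]].
  apply: (@glue _ T T _ (change_at a b t) a y z j i n) => //.
  - by rewrite /d; lia.
  - by lia.
  - move=> s lt_sj; rewrite /change_at /= gl //; split=> //.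
    by apply: yP; lia.
  move=> s /andP[le_is lt_sn]; rewrite /change_at /= gr //; split=> //.
    by case: eqP => // eq_t; lia.
  by apply: zP; rewrite le_is.
(* In the original word the change sits at [t - d], which is at least [i]. The run reads unchanged
   letters before [i], so its state at [i] is also reachable at [j]. *)
have [y yP] : accepts T n (change_at a b (t - d)).
  by apply: acc; rewrite /d in lt_t *; lia.
have : y i \in reach T a j.
  rewrite -eqr inE; apply/asboolP; exists y; split=> // s lt_si.
  have := yP s; rewrite /step /change_at.
  case: eqP => [|_]; last by apply; lia.
  by rewrite /d; lia.
rewrite inE => /asboolP[z [zj zP]].
apply: (@glue _ T T _ a (change_at a b (t - d)) z y j i n) => //.
- by rewrite /d; lia.
- by lia.
- move=> s lt_sj; rewrite /change_at /= gl //; split=> //; last exact: zP.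
  by case: eqP => // eq_t; lia.
move=> s /andP[le_is lt_sn]; rewrite /change_at /= gr //; split=> //.
  have -> // : (s - i + j == t) = (s == t - d) by rewrite /d; lia.
exact: yP.
Qed.

(** Each pumping lengthens the chain and only reuses its links, so a property [C] of the links
    survives; [C] will be membership in the closure. *)
Lemma pump_iter T n a b N (C : predicate k 3 -> Prop) :
  2 ^ (2 * k) <= n -> critical T n a b -> (forall i, i < n -> C (T i)) ->
  exists m T' a' b',
    [/\ N <= m, critical T' m a' b' & forall i, i < m -> C (T' i)].
Proof.
move=> le_n crit TC.
(* The invariant [n <= m] keeps the chain long enough to be pumped again. *)
suff: exists m T' a' b', [/\ N <= m, n <= m, critical T' m a' b'
    & forall i, i < m -> C (T' i)].
  by move=> [m [T' [a' [b' []]]]]; exists m, T', a', b'.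
elim: N => [|N [m [T' [a' [b' [leN le_nm crit' TC']]]]]].
  by exists n, T, a, b.
have [d [g [d_gt0 gP critg]]] := pump (leq_trans le_n le_nm) crit'.
exists (m + d), (T' \o g), (a' \o g), (b' \o g); split=> //; try lia.
by move=> i /gP/TC'.
Qed.

Lemma eq_accepts T n x x' : (forall i, i < n -> x i = x' i) ->
  accepts T n x -> accepts T n x'.
Proof.
move=> eqx [y yP]; exists y => i lt_in.
by rewrite /step -eqx //; exact: yP.
Qed.

Lemma critical_of_accepts T n (rho : predicate k n) : 0 < n ->
  (forall x, rho [tuple x i | i < n] <-> accepts T n x) ->
  essential rho -> exists a b, critical T n a b.
Proof.
move=> n_gt0 rhoE /critical_of_essential[a [b [nrhoa rhob]]].
pose x0 := tnth a (Ordinal n_gt0).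
exists (nth x0 a), (nth x0 b); split.
  move=> /rhoE; apply/negP; congr (is_true (~~ rho _)): nrhoa.
  by apply: eq_from_tnth => i; rewrite tnth_mktuple (tnth_nth x0).
move=> t lt_tn; apply/rhoE; congr (is_true (rho _)): (rhob (Ordinal lt_tn)).
by apply: eq_from_tnth => i; rewrite !tnth_mktuple !(tnth_nth x0).
Qed.

(** [x0] extends a tuple to a word on [nat], of which [accepts T n] reads the first [n] letters. *)
Definition chain_pred T n (x0 : 'I_k) : predicate k n :=
  [ffun x : n.-tuple 'I_k => `[< accepts T n (nth x0 x) >]].

Lemma chain_pred_essential T n a b :
  critical T n a b -> essential (chain_pred T n (a 0)).
Proof.
move=> [rej acc].
apply: (@essential_of_critical _ _ _ [tuple a i | i < n] [tuple b i | i < n]).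
  rewrite ffunE; apply/asboolPn; apply: contra_not rej; apply: eq_accepts.
  by move=> i lt_in; rewrite -[i]/(val (Ordinal lt_in)) nth_mktuple.
move=> t; rewrite ffunE; apply/asboolP; apply: eq_accepts (acc t (ltn_ord t)).
move=> i lt_in; rewrite -[i]/(val (Ordinal lt_in)).
by rewrite nth_mktuple !tnth_mktuple.
Qed.

Lemma chain_pred_closure (G : set (R_ k)) T n (x0 : 'I_k) :
  (forall i, i < n -> pp_closure G (Tagged (predicate k) (T i))) ->
  pp_closure G (Tagged (predicate k) (chain_pred T n x0)).
Proof.
move=> TG; apply/pp_definableP.
(* The [n] letters are the free variables; the [n.+1] states, both ends included, are the bound
   ones. *)
pose stepv (i : 'I_n) (u : 'I_n + 'I_n.+1 -> 'I_k) : Prop :=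
  T i [tuple u (inr (widen_ord (leqnSn n) i)); u (inl i); u (inr (lift ord0 i))].
have stepvD i : pp_definable G (stepv i).
  pose h (j : 'I_3) : 'I_n + 'I_n.+1 := tnth
    [tuple inr (widen_ord (leqnSn n) i); inl i; inr (lift ord0 i)] j.
  have /pp_definableP/(pp_definable_rename h) := TG i (ltn_ord i).
  apply: pp_definable_ext => u; rewrite /stepv.
  set t1 := mktuple _; set t2 := [tuple _; _; _].
  suff -> : t1 = t2 by [].
  by apply: eq_from_tnth => -[[|[|[|//]]] lt_j]; rewrite tnth_mktuple.
apply: pp_definable_ext (pp_definable_ex (pp_definable_all stepvD)) => v.
have vE (i : 'I_n) : nth x0 [tuple v i | i < n] i = v i by exact: nth_mktuple.
rewrite ffunE; split=> [[u uP]|/asboolP[y yP]].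
  apply/asboolP; exists (u \o inord) => i lt_in.
  have := uP (Ordinal lt_in); rewrite /stepv /= /step /=.
  rewrite (vE (Ordinal lt_in)); congr (is_true (T i [tuple u _; _; u _])).
    by apply: val_inj; rewrite /= inordK // ltnW.
  by apply: val_inj; rewrite /= inordK.
exists (fun j : 'I_n.+1 => y j) => i; have := yP i (ltn_ord i).
by rewrite /step /= vE.
Qed.

End Chain.

(** * Infinitely many essential predicates from unbounded arities *)

Lemma infinite_of_unbounded (T : choiceType) (A : set T) (f : T -> nat) :
  (forall N, exists2 p, A p & N <= f p) -> infinite_set A.
Proof.
move=> unb /finite_seqP[s As].
have [p] := unb (\max_(q <- s) f q).+1; rewrite As /= => ps.
by rewrite ltnNge leq_bigmax_seq.
Qed.

Theorem theorem6 (k : nat) (G : set (R_ k)) (n : nat) (rho : predicate k n)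
    (rho_first rho_last : predicate k 2) (rho_mid : nat -> predicate k 3)
    (rho_ess : essential rho)
    (n_large : 2 ^ (2 * k ^ 2) + 2 < n)
    (first_in : pp_closure G (Tagged (predicate k) rho_first))
    (mid_in : forall i : nat, 1 < i < n ->
       pp_closure G (Tagged (predicate k) (rho_mid i)))
    (last_in : pp_closure G (Tagged (predicate k) rho_last))
    (rhoE : forall x : nat -> 'I_k,
       rho [tuple x i.+1 | i < n] <->
       exists y : nat -> 'I_k,
         [/\ rho_first [tuple x 1; y 1],
             forall i : nat, 1 < i < n -> rho_mid i [tuple y i.-1; x i; y i]
           & rho_last [tuple y n.-1; x n]]) :
  infinite_set
    [set p : R_ k | pp_closure G p /\ essential (tagged p)]%classic.
Proof.
(* The pumping bound follows from the assumed one because [k <= k ^ 2]. *)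
have le_n : 2 ^ (2 * k) <= n.
  apply: leq_trans (_ : 2 ^ (2 * k ^ 2) <= n); last by lia.
  by rewrite leq_exp2l // leq_mul2l -mulnn; case: (k) => // k'; rewrite leq_pmull.
(* With dummy variables y_0 and y_n all links of the chain become ternary;
   link i reads x_{i+1} between y_i and y_{i+1}. *)
pose first3 : predicate k 3 :=
  [ffun t => rho_first [tuple tnth t (inord 1); tnth t (inord 2)]].
pose last3 : predicate k 3 :=
  [ffun t => rho_last [tuple tnth t (inord 0); tnth t (inord 1)]].
pose T i :=
  if i == 0 then first3 else if i == n.-1 then last3 else rho_mid i.+1.
have first3E u v w : first3 [tuple u; v; w] = rho_first [tuple v; w].
  by rewrite ffunE !(tnth_nth u) /= !inordK.
have last3E u v w : last3 [tuple u; v; w] = rho_last [tuple u; v].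
  by rewrite ffunE !(tnth_nth u) /= !inordK.
have TG i : i < n -> pp_closure G (Tagged (predicate k) (T i)).
  rewrite /T; case: eqP => [_ _|i0].
    apply: (pp_closure_rename (h := tnth [tuple inord 1; inord 2])) first_in => x.
    rewrite ffunE; congr (rho_first _).
    by apply: eq_from_tnth => -[[|[|//]] lt_j]; rewrite tnth_mktuple.
  case: eqP => [_ _|i_last lt_in]; last by apply: mid_in; lia.
  apply: (pp_closure_rename (h := tnth [tuple inord 0; inord 1])) last_in => x.
  rewrite ffunE; congr (rho_last _).
  by apply: eq_from_tnth => -[[|[|//]] lt_j]; rewrite tnth_mktuple.
have rhoT (x : nat -> 'I_k) : rho [tuple x i | i < n] <-> accepts T n x.
  (* [rhoE] counts letters from 1 and [accepts] from 0; [predn] makes the shift, while the states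
     keep their indices. *)
  rewrite (rhoE (x \o predn)) /accepts /step; split.
    move=> [y [y1 yi yn]]; exists y => i lt_in; rewrite /T.
    case: eqP => [->|i0]; first by rewrite first3E.
    case: eqP => [->|i_last]; first by rewrite last3E.
    by apply: (yi i.+1); lia.
  move=> [y yP]; exists y; split.
  - by have := yP 0; rewrite /T /= first3E; apply; lia.
  - move=> [|i] // lt_in; have := yP i; rewrite /T.
    do 2![case: eqP => [|_]; first by lia].
    by apply; lia.
  have := yP n.-1; rewrite /T.
  case: eqP => [|_]; first by lia.
  by rewrite eqxx last3E; apply; lia.
have [|a [b crit]] := critical_of_accepts _ rhoT rho_ess; first by lia.
(* The tag is the arity, so it suffices to find essential predicates of arity at least any given
   [N]. *)
apply: (infinite_of_unbounded (f := tag)) => N.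
have [m [T' [a' [b' [leN crit' TG']]]]] := pump_iter N
  (C := fun q => pp_closure G (Tagged (predicate k) q)) le_n crit TG.
exists (Tagged (predicate k) (chain_pred T' m (a' 0))) => //.
by split; [exact: chain_pred_closure | exact: chain_pred_essential crit'].
Qed.
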